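(* Let $m\ge 0$ be an integer and let $\Lambda^2=\mathbb{R}\times\mathbb{R}$. Let $P(m,b,x)$ be the polynomial in $b,x$ defined in the context. Then for every $t\in\mathbb{R}$, $$\frac{d x^{2m+1}}{dx}(t)=\lim_{\Delta t\to 0}\frac{\partial P(m,b,x)}{\partial x}(m,t+\Delta t,t)+\frac{\partial P(m,b,x)}{\partial b}(m,t,t),$$ where the left-hand side and the partial derivatives are the classical ones, and the arguments are listed in the order $(m,b,x)$, so that the first term is evaluated at $(x,b)=(t,\sigma(t))$ with $\sigma(t)=t+\Delta t$, $\Delta t\to0$, and the second at $(x,b)=(t,t)$.
   Context: The polynomial $P$. Define real coefficients $\mathbf{A}_{m,r}$, $0\le r\le m$, recursively (downward in $r$) by $\mathbf{A}_{m,m}=(2m+1)\binom{2m}{m}$ and, for $0\le r<m$, $\mathbf{A}_{m,r}=(2r+1)\binom{2r}{r}\sum_{d=2r+1}^{m}\mathbf{A}_{m,d}\binom{d}{2r+1}\frac{(-1)^{d-1}}{d-r}B_{2d-2r}$, where $B_k$ are the Bernoulli numbers (an empty sum is $0$). For nonnegative integers $b$, $P(m,b,x)=\sum_{k=0}^{b-1}\sum_{r=0}^{m}\mathbf{A}_{m,r}\,k^r(x-k)^r$ with the convention $0^0=1$. This is a polynomial in $x$ and $b$, and for arbitrary real $b,x$ the symbol $P(m,b,x)$ denotes the value of the unique polynomial in $b$ and $x$ that agrees with this sum for all nonnegative integers $b$ and all real $x$. *)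

(* Defs.v *)
From mathcomp Require Import all_boot all_order all_algebra.
From mathcomp Require Import all_classical all_reals all_analysis.
From mathcomp Require Import zify.

Set Implicit Arguments.
Unset Strict Implicit.
Unset Printing Implicit Defensive.

Import Order.TTheory GRing.Theory Num.Theory.
Import numFieldNormedType.Exports.

Local Open Scope ring_scope.

(** Bernoulli numbers, with the convention B_1 = -1/2 (the index 1 is never
    used below).  [bernoulli_seq F n] lists B_0, ..., B_(n-1). *)
Fixpoint bernoulli_seq (F : fieldType) (n : nat) : seq F :=
  if n is n'.+1 then
    let s := bernoulli_seq F n' in
    rcons s (if n' == 0 then 1
             else - n'.+1%:R^-1 * \sum_(0 <= k < n') 'C(n'.+1, k)%:R * s`_k)
  else [::].

Definition bernoulli_num (F : fieldType) (n : nat) : F :=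
  (bernoulli_seq F n.+1)`_n.

(** The coefficients A_(m,r).  The recursion goes downward in [r], so it is run
    on the list [coefA_seq F m j] = A_(m,m-j+1), ..., A_(m,m); thus A_(m,d) is
    entry [d - r - 1] of the list [s] from which A_(m,r) is computed. *)
Fixpoint coefA_seq (F : fieldType) (m j : nat) : seq F :=
  if j is j'.+1 then
    let s := coefA_seq F m j' in
    let r := (m - j')%N in
    let c := ((2 * r).+1 * 'C(2 * r, r))%:R in
    (if j' == 0 then c
     else c * \sum_((2 * r).+1 <= d < m.+1)
                s`_(d - r - 1) * 'C(d, (2 * r).+1)%:R
                * ((-1) ^+ (d - 1) / (d - r)%:R)
                * bernoulli_num F (2 * d - 2 * r)) :: s
  else [::].

Definition coefA (F : fieldType) (m r : nat) : F := (coefA_seq F m m.+1)`_r.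

(** [p : {poly {poly R}}] is read as a polynomial in b (outer variable) with
    coefficients polynomial in x (inner variable). *)
Definition agrees_with_sum (R : realType) (m : nat) (p : {poly {poly R}}) :=
  forall (b : nat) (x : R),
    p.[b%:R%:P].[x] =
    \sum_(0 <= k < b) \sum_(0 <= r < m.+1)
      coefA R m r * k%:R ^+ r * (x - k%:R) ^+ r.

Section BernoulliAndCoefA.
Variable F : fieldType.

Lemma size_bernoulli_seq n : size (bernoulli_seq F n) = n.
Proof. by elim: n => //= n IH; rewrite size_rcons IH. Qed.

Lemma nth_bernoulli_seq n k : (k < n)%N ->
  (bernoulli_seq F n)`_k = bernoulli_num F k.
Proof.
elim: n => // n IH; rewrite ltnS leq_eqVlt => /orP[/eqP->//|kn].
by rewrite /= nth_rcons size_bernoulli_seq kn IH.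
Qed.

Lemma bernoulli_num0 : bernoulli_num F 0 = 1.
Proof. by []. Qed.

Lemma bernoulli_num_rec n : (0 < n)%N ->
  bernoulli_num F n =
  - n.+1%:R^-1 * \sum_(0 <= k < n) 'C(n.+1, k)%:R * bernoulli_num F k.
Proof.
case: n => // n _; rewrite {1}/bernoulli_num [bernoulli_seq F n.+2]/=.
rewrite -/(bernoulli_seq F n.+1) nth_rcons size_bernoulli_seq ltnn eqxx.
congr (_ * _); apply: eq_big_nat => k /andP[_ kn].
by rewrite -(nth_bernoulli_seq kn).
Qed.

Lemma size_coefA_seq m j : size (coefA_seq F m j) = j.
Proof. by elim: j => //= j ->. Qed.

Lemma nth_coefA_seq m j i : (j <= m.+1)%N ->
  (coefA_seq F m j)`_i = coefA F m (m.+1 - j + i).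
Proof.
move=> jm; rewrite /coefA.
have: (m.+1 = m.+1 - j + j)%N by rewrite subnK.
move: (m.+1 - j)%N => k ->{jm}.
by elim: k => // k IH; rewrite !addSn.
Qed.

Lemma coefA_diag m : coefA F m m = ((2 * m).+1 * 'C(2 * m, m))%:R.
Proof.
have := @nth_coefA_seq m 1 0 isT.
by rewrite subn1 addn0 /= subn0 => <-.
Qed.

Lemma coefA_rec m r : (r < m)%N ->
  coefA F m r =
  ((2 * r).+1 * 'C(2 * r, r))%:R *
  \sum_((2 * r).+1 <= d < m.+1)
     coefA F m d * 'C(d, (2 * r).+1)%:R * ((-1) ^+ (d - 1) / (d - r)%:R)
     * bernoulli_num F (2 * d - 2 * r).
Proof.
move=> rm; have jm : ((m - r).+1 <= m.+1)%N by rewrite ltnS leq_subr.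
have := @nth_coefA_seq m _ 0 jm.
rewrite subSS addn0 subKn 1?ltnW // => <-.
rewrite [coefA_seq _ _ _]/= subKn 1?ltnW // subn_eq0 leqNgt rm /=.
congr (_ * _); apply: eq_big_nat => d /andP[rd dm].
rewrite nth_coefA_seq; last by rewrite leqW // leq_subr.
by congr (coefA _ _ _ * _ * _ * _); lia.
Qed.

End BernoulliAndCoefA.

Section PolynomialP.
Variable R : realType.

Lemma ex_power_sum (j : nat) : exists q : {poly R},
  forall b : nat, q.[b%:R] = \sum_(0 <= k < b) k%:R ^+ j.
Proof.
elim/ltn_ind: j => j IH.
have /fin_all_exists[q qP] : forall i : 'I_j, exists q : {poly R},
    forall b : nat, q.[b%:R] = \sum_(0 <= k < b) k%:R ^+ i.
  by move=> i; apply: IH.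
exists (j.+1%:R^-1 *: ('X^(j.+1) - \sum_(i < j) 'C(j.+1, i)%:R *: q i)) => b.
have j0 : j.+1%:R != 0 :> R by rewrite pnatr_eq0.
apply: (mulfI j0); rewrite hornerZ mulVKf // !hornerE horner_sum.
apply/eqP; rewrite subr_eq; apply/eqP.
have -> : b%:R ^+ j.+1 =
    \sum_(0 <= k < b) (k.+1%:R ^+ j.+1 - k%:R ^+ j.+1) :> R.
  by rewrite telescope_sumr // expr0n subr0.
under [X in _ = _ + X]eq_bigr => i _ do rewrite hornerZ qP mulr_sumr.
rewrite exchange_big /= mulr_sumr -big_split /=; apply: eq_bigr => k _.
rewrite -natr1 [_ + 1]addrC exprDn 2!big_ord_recr /= binn binSn !expr1n !mul1r mulr1n.
rewrite addrK mulr_natl [LHS]addrC; congr (_ + _).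
by apply: eq_bigr => i _; rewrite expr1n mul1r mulr_natl.
Qed.

Lemma agrees_with_sum_exists m :
  exists p : {poly {poly R}}, agrees_with_sum m p.
Proof.
have /choice[q qP] := ex_power_sum.
pose f : {poly {poly R}} := \sum_(0 <= r < m.+1)
  (coefA R m r)%:P%:P * 'X^r * ('X%:P - 'X) ^+ r.
exists (\sum_(j < size f) f`_j *: map_poly polyC (q j)) => b x.
transitivity (\sum_(0 <= k < b) f.[k%:R%:P].[x]).
  move: f => f; rewrite 2!horner_sum.
  under [RHS]eq_bigr => k _ do rewrite (horner_coef f) horner_sum.
  rewrite exchange_big /=; apply: eq_bigr => j _.
  rewrite hornerZ horner_map /= hornerM hornerC qP mulr_sumr.
  by apply: eq_bigr => k _; rewrite -polyC_exp hornerM hornerC.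
apply: eq_bigr => k _; rewrite /f horner_sum horner_sum.
by apply: eq_bigr => r _; rewrite !hornerE.
Qed.

Lemma agrees_with_sum_unique m (p q : {poly {poly R}}) :
  agrees_with_sum m p -> agrees_with_sum m q -> p = q.
Proof.
have nat_root (S : idomainType) (f : nat -> S) (s : {poly S}) :
    injective f -> (forall n, s.[f n] = 0) -> s = 0.
  move=> finj s0; apply/eqP/negPn/negP => snz.
  have := @max_poly_roots _ s [seq f i | i <- iota 0 (size s)] snz.
  rewrite map_inj_uniq // iota_uniq size_map size_iota ltnn.
  suff -> : all (root s) [seq f i | i <- iota 0 (size s)] by move=> /(_ isT isT).
  by apply/allP => _ /mapP[i _ ->]; rewrite /root s0.
have Rinj : injective (fun n : nat => n%:R : R).
  by move=> a b /eqP; rewrite eqr_nat => /eqP.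
move=> pP qP; apply/eqP; rewrite -subr_eq0; apply/eqP.
apply: (nat_root _ (fun n : nat => (n%:R : R)%:P)) => [a b /polyC_inj/Rinj//|b].
apply: (nat_root _ _ _ Rinj) => n.
by rewrite hornerD hornerN hornerD hornerN pP qP subrr.
Qed.

End PolynomialP.

Definition polyP (R : realType) (m : nat) : {poly {poly R}} :=
  sval (cid (agrees_with_sum_exists R m)).

Lemma polyP_agrees (R : realType) (m : nat) : agrees_with_sum m (polyP R m).
Proof. exact: svalP. Qed.

Definition P (R : realType) (m : nat) (b x : R) : R := (polyP R m).[b%:P].[x].

(* Main.v *)
Require Import Defs.
From mathcomp Require Import all_boot all_order all_algebra.
From mathcomp Require Import all_classical all_reals all_analysis.
From mathcomp Require Import zify ring.

Import Order.TTheory GRing.Theory Num.Theory.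
Import numFieldNormedType.Exports.

Local Open Scope classical_set_scope.
Local Open Scope ring_scope.

(** The whole content is that [P] restricted to the diagonal [b = x] is a pure
    power: [P(m, x, x) = x^(2m+1)] ([polyP_diag]).  Differentiating this
    identity with the chain rule ([deriv_horner_poly]) splits the derivative of
    [x^(2m+1)] at [t] into the two partial derivatives of [P] at [(t, t)].  The
    limit over [dt] is then harmless, because [dP/dx] is a polynomial and hence
    continuous in its argument [b].

    The diagonal identity says that the sum over [k < n] of the
    [A_(m,r) k^r (n-k)^r] is [n^(2m+1)].  Expanding [(n-k)^r] and summing the
    powers of [k] by Faulhaber's formula ([sum_exprn_bernoulli]) turns
    [\sum_(k < n) k^r (n-k)^r] into a polynomial in [n] whose coefficients are
    alternating sums of binomials ([altsum_bin_bin], [altsum_bin_inv]).  They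
    can be evaluated: the term [n^(2r+1)] has coefficient [r!^2 / (2r+1)!], the
    only other surviving powers are the odd ones [n^(2q+1)], with
    [2q + 1 <= r], and their coefficients are

      [C(r, 2q+1) (-1)^r / (r-q) B_(2r-2q)]

    ([sum_conv_exprn]).  The coefficients [A_(m,r)] solve the triangular linear
    system that this formula produces: the diagonal value [A_(m,m)] inverts
    [m!^2 / (2m+1)!] ([coefA_diag_norm]), so that [n^(2m+1)] gets coefficient
    [1], and the downward recursion for [A_(m,q)] says exactly that [n^(2q+1)]
    gets coefficient [0] for [q < m] ([coefA_norm]). *)

(** * Faulhaber's formula *)

(** The values at [1] and at [0] of the Bernoulli polynomial [B_n(x)] agree,
    except for [n = 1]; for [n > 1] this is the recursion of the [B_i]. *)
Lemma sum_bin_bernoulli (F : numFieldType) (n : nat) :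
  \sum_(i < n.+1) 'C(n, i)%:R * bernoulli_num F i
  = bernoulli_num F n + (n == 1%N)%:R.
Proof.
rewrite big_ord_recr /= binn mul1r addrC; congr (_ + _).
case: n => [|[|n]]; first by rewrite big_ord0.
  by rewrite big_ord1 bin0 mul1r.
rewrite big_ord_recr /= binSn (@bernoulli_num_rec _ n.+1) //.
rewrite big_mkord mulrA mulrN divff ?pnatr_eq0 //.
by rewrite mulN1r subrr.
Qed.

(** Newton's formula with a summation range independent of the exponent, so
    that sums over several exponents can be exchanged. *)
Lemma exprDn_wide (F : comNzRingType) (x : F) (d n : nat) : (d <= n)%N ->
  (x + 1) ^+ d = \sum_(l < n.+1) 'C(d, l)%:R * x ^+ l.
Proof.
move=> dn; rewrite addrC exprDn.
rewrite (big_ord_widen n.+1 (fun l => 1 ^+ (d - l) * x ^+ l *+ 'C(d, l))) //.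
rewrite big_mkcond; apply: eq_bigr => l _.
rewrite expr1n mul1r -mulr_natl ltnS; case: leqP => // /bin_small ->.
by rewrite mul0r.
Qed.

(** The difference equation [B_(n+1)(x+1) - B_(n+1)(x) = (n+1) x^n] of the
    Bernoulli polynomials. *)
Lemma bernoulli_poly_step (F : numFieldType) (n : nat) (x : F) :
  \sum_(i < n.+2) 'C(n.+1, i)%:R * bernoulli_num F i * (x + 1) ^+ (n.+1 - i)
  = \sum_(i < n.+2) 'C(n.+1, i)%:R * bernoulli_num F i * x ^+ (n.+1 - i)
    + n.+1%:R * x ^+ n.
Proof.
under eq_bigr => i _ do
  rewrite (@exprDn_wide _ x _ n.+1) ?leq_subr // mulr_sumr.
rewrite exchange_big /=.
transitivity (\sum_(l < n.+2) 'C(n.+1, l)%:R * x ^+ l *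
    (bernoulli_num F (n.+1 - l) + (n.+1 - l == 1)%N%:R)).
  apply: eq_bigr => -[l /= ll] _; rewrite -sum_bin_bernoulli.
  rewrite (big_ord_widen n.+2
    (fun i => 'C(n.+1 - l, i)%:R * bernoulli_num F i)); last lia.
  rewrite mulr_sumr [RHS]big_mkcond /=; apply: eq_bigr => -[i /= il] _.
  have [lt_i|gt_i] := ltnP i (n.+1 - l).+1; last first.
    by rewrite (@bin_small (n.+1 - i) l) ?mul0r ?mulr0 //; lia.
  (* Both sides are the trinomial coefficient (n+1)! / (i! l! (n+1-i-l)!). *)
  have E : ('C(n.+1, i) * 'C(n.+1 - i, l) = 'C(n.+1, l) * 'C(n.+1 - l, i))%N.
    have f0 : (0 < i`! * l`! * (n.+1 - i - l)`!)%N by rewrite !muln_gt0 !fact_gt0.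
    have h1 := @bin_fact n.+1 i ltac:(lia).
    have h2 := @bin_fact (n.+1 - i) l ltac:(lia).
    have h3 := @bin_fact n.+1 l ltac:(lia).
    have h4 := @bin_fact (n.+1 - l) i ltac:(lia).
    have e : (n.+1 - l - i = n.+1 - i - l)%N by lia.
    apply/eqP; rewrite -(eqn_pmul2r f0); apply/eqP.
    transitivity (n.+1)`!; last by rewrite -h3 -h4 e; ring.
    by rewrite -h1 -h2; ring.
  have {}E := congr1 (fun k => k%:R : F) E; rewrite /= !natrM in E.
  transitivity ('C(n.+1, i)%:R * 'C(n.+1 - i, l)%:R
                * (bernoulli_num F i * x ^+ l)); first by ring.
  by rewrite E; ring.
rewrite (eq_bigr _ (fun l _ => mulrDr _ _ _)).
rewrite big_split /=; congr (_ + _).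
  rewrite (reindex_inj rev_ord_inj) /=; apply: eq_bigr => -[i /= il] _.
  rewrite subSS subKn // bin_sub //; ring.
rewrite 2!big_ord_recr /= subnn mulr0 addr0 subSnn binSn mulr1.
rewrite big1 ?add0r // => -[l /= ll] _.
by rewrite (_ : (n.+1 - l == 1)%N = false) ?mulr0 //; lia.
Qed.

(** Faulhaber's formula, with the constant term of the Bernoulli polynomial
    first included in the sum and then subtracted: in this form the range of
    [i] can be enlarged freely, because the binomials vanish beyond it. *)
Lemma sum_exprn_bernoulli (F : numFieldType) (j n : nat) :
  \sum_(0 <= k < n) k%:R ^+ j = j.+1%:R^-1 *
    (\sum_(i < j.+2) 'C(j.+1, i)%:R * bernoulli_num F i * n%:R ^+ (j.+1 - i)
     - bernoulli_num F j.+1).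
Proof.
have j0 : j.+1%:R != 0 :> F by rewrite pnatr_eq0.
apply: (mulfI j0); rewrite mulVKf //.
elim: n => [|n IH].
  rewrite big_nil mulr0 big_ord_recr /= binn subnn mul1r mulr1 addrK.
  rewrite big1 // => -[i /= il] _.
  by rewrite expr0n (_ : (j.+1 - i == 0)%N = false) ?mulr0 //; lia.
rewrite big_nat_recr //= mulrDr IH -[n.+1%:R]natr1 bernoulli_poly_step; ring.
Qed.

(** * Alternating sums of binomials *)

(** An [r]-th finite difference of a binomial: compare the coefficients of
    ['X^s] in [(1 + X)^a (1 - (1 + X))^r = (-1)^r X^r (1 + X)^a]. *)
Lemma altsum_bin_bin (F : comNzRingType) (r a s : nat) :
  \sum_(j < r.+1) (-1) ^+ j * 'C(r, j)%:R * 'C(a + j, s)%:R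
  = if (s < r)%N then 0 else (-1) ^+ r * 'C(a, s - r)%:R :> F.
Proof.
have coefE1X d i : ((1 + 'X) ^+ d : {poly F})`_i = 'C(d, i)%:R.
  have -> : (1 + 'X) ^+ d = \poly_(l < d.+1) 'C(d, l)%:R :> {poly F}.
    rewrite exprDn poly_def; apply: eq_bigr => l _.
    by rewrite expr1n mul1r scaler_nat.
  by rewrite coef_poly ltnS; case: leqP => // /bin_small ->.
have : \sum_(j < r.+1) ((-1) ^+ j * 'C(r, j)%:R)%:P * (1 + 'X) ^+ (a + j)
       = 'X^r * (((-1) ^+ r)%:P * (1 + 'X) ^+ a) :> {poly F}.
  transitivity ((1 + 'X) ^+ a * (1 - (1 + 'X)) ^+ r : {poly F}).
    rewrite [(1 - _) ^+ r]exprDn mulr_sumr; apply: eq_bigr => j _.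
    rewrite expr1n mul1r -[in RHS]mulr_natl polyCM polyC_exp polyCN polyC_natr.
    rewrite exprD [(- (1 + 'X)) ^+ j]exprNn; ring.
  rewrite opprD addrA subrr add0r polyC_exp polyCN [(- 'X) ^+ r]exprNn; ring.
move=> /(congr1 (fun p : {poly F} => p`_s)).
rewrite coef_sum coefXnM coefCM coefE1X => <-.
by apply: eq_bigr => j _; rewrite coefCM coefE1X.
Qed.

(** The Beta integral of [x^a (1 - x)^r], expanded in powers of [x].  The
    induction on [r] writes [(1 - x)^(r+1)] as [(1 - x)^r - x (1 - x)^r]. *)
Lemma altsum_bin_inv (F : numFieldType) (r a : nat) :
  \sum_(j < r.+1) (-1) ^+ j * 'C(r, j)%:R / (a + j).+1%:R
  = r`!%:R * a`!%:R / (a + r).+1`!%:R :> F.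
Proof.
elim: r a => [|r IH] a.
  rewrite big_ord1 /= !mul1r addn0 factS natrM.
  by field; rewrite nat1r !pnatr_eq0 -!lt0n fact_gt0.
transitivity (\sum_(j < r.+1) (-1) ^+ j * 'C(r, j)%:R / (a + j).+1%:R
   - \sum_(j < r.+1) (-1) ^+ j * 'C(r, j)%:R / (a.+1 + j).+1%:R : F).
  rewrite big_ord_recl [X in _ = X - _]big_ord_recl /= !bin0 -addrA.
  congr (_ + _).
  rewrite [X in _ = X - _](_ : _ = \sum_(j < r.+1)
      (-1) ^+ j.+1 * 'C(r, j.+1)%:R / (a + j.+1).+1%:R); last first.
    by rewrite [RHS]big_ord_recr /= (@bin_small r r.+1) // mulr0 mul0r addr0.
  rewrite -sumrB; apply: eq_bigr => j _.
  rewrite /bump /= add1n binS natrD addSnnS exprS; ring.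
have factE k : k.+1`!%:R = (k%:R + 1) * k`!%:R :> F by rewrite factS natrM natr1.
rewrite !IH addnS addSn !factE -!natr1 natrD.
have f0 : (a + r)`!%:R != 0 :> F by rewrite pnatr_eq0 -lt0n fact_gt0.
have g0 : a%:R + r%:R + 1 != 0 :> F by rewrite -natrD natr1 pnatr_eq0.
have h0 : a%:R + r%:R + 1 + 1 != 0 :> F by rewrite -natrD !natr1 pnatr_eq0.
move: (r`!%:R : F) (a`!%:R : F) ((a + r)`!%:R : F) f0 => u v w f0.
by field; rewrite f0 g0 h0.
Qed.

(** * The sums of k^r (n-k)^r *)

Lemma sum_even_odd (V : nmodType) (f : nat -> V) (p : nat) :
  \sum_(l < p.*2) f l = \sum_(q < p) (f q.*2 + f q.*2.+1).
Proof.
elim: p => [|p IH]; first by rewrite !big_ord0.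
by rewrite doubleS !big_ord_recr /= IH addrA.
Qed.

(** Faulhaber's formula contributes twice to the power [n^(r-j)]: its
    terms of index [i = r+j+1] add up to a finite difference, which gives the
    sign [(-1)^r], and the subtracted constant term gives [(-1)^j]. *)
Lemma sum_conv_exprn_full (F : numFieldType) (r n : nat) :
  \sum_(0 <= k < n) k%:R ^+ r * (n%:R - k%:R) ^+ r
  = r`!%:R * r`!%:R / (2 * r).+1`!%:R * n%:R ^+ (2 * r).+1
    + \sum_(j < r.+1) 'C(r, j)%:R / (r + j).+1%:R * bernoulli_num F (r + j).+1
        * ((-1) ^+ r - (-1) ^+ j) * n%:R ^+ (r - j).
Proof.
transitivity (\sum_(j < r.+1) (-1) ^+ j * 'C(r, j)%:R * n%:R ^+ (r - j)
                * \sum_(0 <= k < n) k%:R ^+ (r + j) : F).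
  under [RHS]eq_bigr => j _ do rewrite mulr_sumr.
  rewrite exchange_big /=; apply: eq_bigr => k _.
  rewrite exprBn mulr_sumr; apply: eq_bigr => j _.
  by rewrite -[_ *+ 'C(r, j)]mulr_natr exprD; ring.
pose g i := bernoulli_num F i * n%:R ^+ ((2 * r).+1 - i).
pose c j := (-1) ^+ j * 'C(r, j)%:R / (r + j).+1%:R : F.
transitivity (\sum_(i < (2 * r).+2) g i * \sum_(j < r.+1) c j * 'C((r + j).+1, i)%:R
   - \sum_(j < r.+1) c j * n%:R ^+ (r - j) * bernoulli_num F (r + j).+1).
  under [X in _ = X - _]eq_bigr => i _ do rewrite mulr_sumr.
  rewrite exchange_big /= -sumrB; apply: eq_bigr => -[j /= jr] _.
  rewrite sum_exprn_bernoulli mulrA.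
  rewrite (_ : _ / _ = c j * n%:R ^+ (r - j)); last by rewrite /c; ring.
  rewrite mulrBr; congr (_ - _).
  rewrite (big_ord_widen (2 * r).+2 (fun i => 'C((r + j).+1, i)%:R *
    bernoulli_num F i * n%:R ^+ ((r + j).+1 - i))); last lia.
  rewrite big_mkcond mulr_sumr; apply: eq_bigr => -[i /= ir] _; rewrite /g.
  case: ltnP => [ij|/bin_small->]; last by rewrite !mulr0.
  rewrite (_ : (2 * r).+1 - i = r - j + ((r + j).+1 - i))%N; last lia.
  by rewrite exprD; ring.
rewrite big_ord_recl /= {1}/g bernoulli_num0 subn0 mul1r -addrA.
congr (_ + _).
  under eq_bigr => j _ do rewrite bin0 mulr1.
  by rewrite altsum_bin_inv addnn mul2n mulrC.
(* The r-th finite difference vanishes below degree r: only the powers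
   n^(2r-i) with r <= i remain. *)
have cE i : \sum_(j < r.+1) c j * 'C((r + j).+1, i.+1)%:R
    = (if (i < r)%N then 0 else (-1) ^+ r * 'C(r, i - r)%:R) / i.+1%:R.
  rewrite -altsum_bin_bin mulr_suml; apply: eq_bigr => j _; rewrite /c.
  have := congr1 (fun k => k%:R : F) (mul_bin_diag (r + j).+1 i).
  rewrite /= !natrM => E.
  have i0 : i.+1%:R != 0 :> F by rewrite pnatr_eq0.
  have j0 : (r + j).+1%:R != 0 :> F by rewrite pnatr_eq0.
  apply: (mulIf i0); apply: (mulIf j0).
  rewrite -[RHS]mulrA [X in _ = X * _]mulrAC.
  transitivity ((-1) ^+ j * 'C(r, j)%:R * (i.+1%:R * 'C((r + j).+1, i.+1)%:R) : F).
    by field.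
  by rewrite -E; field.
under eq_bigr => i _ do rewrite /bump /= add1n cE.
rewrite (_ : (2 * r).+1 = r + r.+1)%N; last lia.
rewrite big_split_ord /= [X in X + _ - _]big1 ?add0r; last first.
  by move=> [i /= ir] _; rewrite ir mul0r mulr0.
rewrite -sumrB; apply: eq_bigr => -[j /= jr] _.
rewrite ltnNge leq_addr /= addKn /g /c.
rewrite (_ : (2 * r).+1 - (r + j).+1 = r - j)%N; last lia.
ring.
Qed.

(** The factor [(-1)^r - (-1)^(r-l)] kills the even powers [n^l] and doubles
    the odd ones.  The range of [q] is enlarged up to [m], where the binomials
    vanish, so that it is the same for all [r <= m]. *)
Lemma sum_conv_exprn (F : numFieldType) (m r n : nat) : (r <= m)%N ->
  \sum_(0 <= k < n) k%:R ^+ r * (n%:R - k%:R) ^+ r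
  = r`!%:R * r`!%:R / (2 * r).+1`!%:R * n%:R ^+ (2 * r).+1
    + \sum_(q < m.+1) 'C(r, (2 * q).+1)%:R * ((-1) ^+ r / (r - q)%:R)
        * bernoulli_num F (2 * r - 2 * q) * n%:R ^+ (2 * q).+1.
Proof.
move=> rm; rewrite sum_conv_exprn_full; congr (_ + _).
rewrite (reindex_inj rev_ord_inj) /=.
pose f l := 'C(r, l)%:R / ((2 * r).+1 - l)%:R
  * bernoulli_num F ((2 * r).+1 - l) * ((-1) ^+ r * (1 - (-1) ^+ l))
  * n%:R ^+ l.
transitivity (\sum_(l < r.+1) f l).
  apply: eq_bigr => -[l /= lr] _; rewrite /f subSS subKn // bin_sub //.
  rewrite (_ : (r + (r - l)).+1 = (2 * r).+1 - l)%N; last lia.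
  have -> : (-1) ^+ (r - l) = (-1) ^+ r * (-1) ^+ l :> F.
    by rewrite -exprD -signr_odd oddB // -oddD signr_odd.
  by rewrite [_ * (1 - _)]mulrBr mulr1.
rewrite (big_ord_widen m.+1.*2 f); last lia.
rewrite big_mkcond /=.
rewrite (eq_bigr (fun l : 'I__ => f l)); last first.
  move=> l _; case: ltnP => // /bin_small; rewrite /f => ->; by rewrite !mul0r.
rewrite sum_even_odd; apply: eq_bigr => q _; rewrite /f -!mul2n.
rewrite -[(-1) ^+ (2 * q)]signr_odd -[(-1) ^+ (2 * q).+1]signr_odd.
rewrite mul2n /= odd_double expr0 expr1 subrr !mulr0 mul0r add0r opprK -mul2n.
have [rq|qr] := leqP r q; first by rewrite bin_small ?mul0r //; lia.
rewrite subSS; have -> : (2 * r - 2 * q = 2 * (r - q))%N by lia.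
rewrite natrM; field; rewrite pnatr_eq0; lia.
Qed.

(** * The coefficients A_(m,r) solve a triangular system *)

Lemma coefA_diag_norm (F : numFieldType) (m : nat) :
  coefA F m m * (m`!%:R * m`!%:R / (2 * m).+1`!%:R) = 1.
Proof.
rewrite coefA_diag -natrM mulrA -natrM.
have -> : ((2 * m).+1 * 'C(2 * m, m) * (m`! * m`!) = (2 * m).+1`!)%N.
  rewrite factS -(@bin_fact (2 * m) m ltac:(lia)) -mulnA.
  by rewrite (_ : 2 * m - m = m)%N //; lia.
by rewrite divff // pnatr_eq0 -lt0n fact_gt0.
Qed.

(** The recursion, divided by [(2r+1) C(2r, r)], with the sum extended to
    all [d <= m] since ['C(d, 2r+1)] vanishes for the new ones. *)
Lemma coefA_norm (F : numFieldType) (m r : nat) : (r < m)%N ->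
  coefA F m r * (r`!%:R * r`!%:R / (2 * r).+1`!%:R)
  = - \sum_(d < m.+1) coefA F m d * ('C(d, (2 * r).+1)%:R *
      ((-1) ^+ d / (d - r)%:R) * bernoulli_num F (2 * d - 2 * r)).
Proof.
(* The prefactor of the recursion for A_(m,r) is A_(r,r). *)
move=> rm; rewrite coefA_rec // mulrAC -coefA_diag coefA_diag_norm mul1r.
rewrite -sumrN.
pose f d := - (coefA F m d * ('C(d, (2 * r).+1)%:R *
      ((-1) ^+ d / (d - r)%:R) * bernoulli_num F (2 * d - 2 * r))).
transitivity (\sum_((2 * r).+1 <= d < m.+1) f d).
  apply: eq_big_nat => -[|d] // _; rewrite /f subn1 /= exprS; ring.
rewrite big_geq_mkord big_mkcond; apply: eq_bigr => d _.
by rewrite /f; case: leqP => /= [dr|//]; rewrite bin_small ?mul0r ?mulr0 ?oppr0.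
Qed.

(** After collecting powers of [n], the coefficient of [n^(2q+1)] is
    [0] for [q < m] and [1] for [q = m]. *)
Lemma sum_coefA_conv_exprn (F : numFieldType) (m n : nat) :
  \sum_(0 <= k < n) \sum_(0 <= r < m.+1)
      coefA F m r * k%:R ^+ r * (n%:R - k%:R) ^+ r
  = n%:R ^+ (2 * m).+1.
Proof.
rewrite exchange_big /= big_mkord.
pose S q := \sum_(d < m.+1) coefA F m d * ('C(d, (2 * q).+1)%:R *
      ((-1) ^+ d / (d - q)%:R) * bernoulli_num F (2 * d - 2 * q)).
transitivity (\sum_(q < m.+1) (coefA F m q * (q`!%:R * q`!%:R / (2 * q).+1`!%:R)
   + S q) * n%:R ^+ (2 * q).+1).
  under [RHS]eq_bigr => q _ do rewrite mulrDl /S mulr_suml.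
  rewrite big_split [X in _ = _ + X]exchange_big -big_split /=.
  apply: eq_bigr => -[r /= rm] _.
  under eq_bigr => k _ do rewrite -mulrA.
  rewrite -mulr_sumr (@sum_conv_exprn _ m) // mulrDr mulrA mulr_sumr.
  by congr (_ + _); apply: eq_bigr => q _; rewrite !mulrA.
rewrite big_ord_recr /= big1 ?add0r => [|[q /= qm] _]; last first.
  by rewrite coefA_norm // addNr mul0r.
rewrite coefA_diag_norm /S big1 ?addr0 ?mul1r // => -[d /= dm] _.
by rewrite bin_small ?mul0r ?mulr0 //; lia.
Qed.

(** * The diagonal of P and its derivative *)

Lemma horner_swap (F : comNzRingType) (p : {poly {poly F}}) (b x : F) :
  p.[b%:P].[x] = (map_poly (horner_eval x) p).[b].
Proof. by rewrite -[in RHS](hornerC b x) horner_map. Qed.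

Lemma horner_diag (F : comNzRingType) (p : {poly {poly F}}) (x : F) :
  p.['X].[x] = p.[x%:P].[x].
Proof.
elim/poly_ind: p => [|p c IH]; first by rewrite !horner0.
by rewrite !hornerE IH.
Qed.

(** Both sides are polynomials in one variable, so it is enough that they agree
    at the natural numbers [n], where the left-hand side is the defining sum
    with [b = x = n]. *)
Lemma polyP_diag (R : realType) (m : nat) : (Defs.polyP R m).['X] = 'X^((2 * m).+1).
Proof.
apply/eqP; rewrite -subr_eq0; apply/negPn/negP => nz.
set D := _ - _ in nz.
have := @max_poly_roots _ D [seq i%:R | i <- iota 0 (size D)] nz.
rewrite map_inj_uniq ?iota_uniq ?size_map ?size_iota ?ltnn; last first.
  by move=> i j /eqP; rewrite eqr_nat => /eqP.
case/(_ _ isT)/negP => //.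
apply/allP => _ /mapP[i _ ->]; rewrite /root /D hornerD hornerN horner_diag hornerXn.
by rewrite polyP_agrees sum_coefA_conv_exprn subrr.
Qed.

(** The chain rule for [x |-> p(q(x), x)]: the operator [map_poly deriv] is the
    partial derivative in the inner variable, [deriv] in the outer one. *)
Lemma deriv_horner_poly (F : comNzRingType) (p : {poly {poly F}}) (q : {poly F}) :
  p.[q]^`() = (map_poly deriv p).[q] + p^`().[q] * q^`().
Proof.
elim/poly_ind: p => [|p c IH].
  by rewrite raddf0 deriv0 !horner0 deriv0 mul0r addr0.
rewrite raddfD /= map_polyC /=.
have -> : map_poly deriv (p * 'X) = map_poly deriv p * 'X.
  by apply/polyP => i; rewrite !(coef_map, coefMX); case: eqP; rewrite ?raddf0.
rewrite !poly.derivE !hornerE /= derivD derivM IH; ring.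
Qed.

(** * The derivative of an odd power *)

Theorem corollary4p6 (R : realType) (m : nat) (t : R) :
  [/\ derivable (fun x : R => x ^+ (2 * m + 1)) t 1,
      (forall dt : R, derivable (fun x : R => P m (t + dt) x) t 1),
      cvg (derive1 (fun x : R => P m (t + dt) x) t @[dt --> 0^']),
      derivable (fun b : R => P m b t) t 1
    & derive1 (fun x : R => x ^+ (2 * m + 1)) t =
      lim (derive1 (fun x : R => P m (t + dt) x) t @[dt --> 0^'])
      + derive1 (fun b : R => P m b t) t].
Proof.
have powE : (fun x : R => x ^+ (2 * m + 1)) = horner 'X^(2 * m + 1).
  by apply/funext => x; rewrite hornerXn.
have bE : (fun b : R => P m b t) = horner (map_poly (horner_eval t) (Defs.polyP R m)).
  by apply/funext => b; rewrite -horner_swap.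
have xE dt : derive1 (fun x : R => P m (t + dt) x) t
    = (map_poly (horner_eval t) (map_poly deriv (Defs.polyP R m))).[t + dt].
  rewrite -[LHS]/((derive1 (horner (Defs.polyP R m).[(t + dt)%:P])) t) -derivE.
  by rewrite deriv_horner_poly derivC mulr0 addr0 horner_swap.
have cvgx : derive1 (fun x : R => P m (t + dt) x) t @[dt --> 0^'] -->
    (map_poly (horner_eval t) (map_poly deriv (Defs.polyP R m))).[t].
  rewrite (funext xE); set p := map_poly _ _; apply: cvg_within_filter.
  have shift : t + dt @[dt --> 0] --> t.
    by rewrite -[X in _ --> X]addr0; apply: cvgD; [exact: cvg_cst | exact: cvg_id].
  exact: (cvg_comp _ _ shift (@continuous_horner R p t)).
split.
- by rewrite powE; exact: derivable_horner.
- by move=> dt; exact: derivable_horner.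
- by apply/cvg_ex; eexists; exact: cvgx.
- by rewrite bE; exact: derivable_horner.
- rewrite (cvg_lim _ cvgx) // powE bE -!derivE addn1 -polyP_diag.
  by rewrite deriv_horner_poly derivX mulr1 hornerD !horner_diag !horner_swap deriv_map.
Qed.
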